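(* Let $f\in\mathrm{RV}_{-1}$ be the radius distribution and assume that for all $\beta\in(0,1)$: $$\limsup_{n\to\infty}\sup_{n^\beta\le x\le n}\frac{xf(x)}{nf(n)}=b(\beta)<\infty\quad\text{and}\quad\limsup_{n\to\infty}\frac{\sum_{i=1}^{n^\beta}f(i)}{f(n)\,n\ln n}=d(\beta)<\infty.$$ Then $(T_nf(n))_n$ is tight. Moreover, for every subsequence $(n_k)_k$ such that $f(n_k)T_{n_k}\Longrightarrow Y$ in distribution, the limit $Y$ (which may depend on $f$ and $(n_k)_k$) is a non-degenerate distribution with compact support.
   Context: Covering process: $R$ takes values in $\{1,2,\dots\}$, $f(r)=\mathbb{P}(R\ge r)$ for real $r\ge1$. On $\mathbb{Z}/n\mathbb{Z}$, let $(R_k)$ be i.i.d. copies of $R$, $(U_k)$ i.i.d. uniform on $\mathbb{Z}/n\mathbb{Z}$, independent; $\mathcal{O}_k=\{U_k,\dots,U_k+R_k-1\}$ (mod $n$), $C_0=\emptyset$, $C_k=C_{k-1}\cup\mathcal{O}_k$; with an independent rate-one Poisson process $N(t)$, $X_t=C_{N(t)}$ and $T_n=\inf\{t:X_t=\mathbb{Z}/n\mathbb{Z}\}$. $U\in\mathrm{RV}_p$ means $U:\mathbb{R}_+\to\mathbb{R}_+$ measurable with $\lim_{x\to\infty}U(xt)/U(x)=t^p$ for all $t>0$. Non-degenerate means not concentrated on a single point. *)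

(* Defs.v *)
From HB Require Import structures.
From mathcomp Require Import all_boot all_order all_algebra.
From mathcomp Require Import all_classical all_reals all_analysis.
Set Implicit Arguments. Unset Strict Implicit. Unset Printing Implicit Defensive.
Import Order.TTheory GRing.Theory Num.Theory.
Import numFieldNormedType.Exports.
Local Open Scope classical_set_scope.
Local Open Scope ring_scope.

Section Covering.
Variable R : realType.

Definition radius_pmf (p : nat -> R) : Prop :=
  p 0%N = 0 /\ (forall k, 0 <= p k) /\
  (fun N => \sum_(k < N) p k) @ \oo --> (1 : R).

(* f(x) = P(R >= x) for real x; equals 1 for x <= 1 since R >= 1 a.s.,
   and 1 - P(R < ceil x) = 1 - sum_{k < ceil x} p k otherwise. *)
Definition tailf (p : nat -> R) (x : R) : R :=
  if x <= 1 then 1 else 1 - \sum_(k < `|Num.ceil x|%N) p k.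

Definition regvar (U : R -> R) (rho : R) : Prop :=
  measurable_fun [set x : R | 0 <= x] U /\
  (forall x, 0 <= x -> 0 <= U x) /\
  (forall t : R, 0 < t -> (fun x => U (x * t) / U x) @ +oo --> t `^ rho).

(* On Z/nZ (represented by 'I_n), an arc O = {u, ..., u + L - 1} mod n only
   depends on u and on min(L, n).  An arc is encoded by (u, r) with
   u, r : 'I_n and min(L,n) = r + 1; it covers j iff (j - u) mod n <= r. *)
Definition covered (n k : nat) (a : {ffun 'I_k -> 'I_n * 'I_n}) : bool :=
  [forall j : 'I_n, [exists i : 'I_k,
     ((j + n - (a i).1) %% n <= (a i).2)%N]].

(* P(min(R, n) = r + 1) *)
Definition wlen (p : nat -> R) (n : nat) (r : 'I_n) : R :=
  if (r.+1 < n)%N then p r.+1 else tailf p n%:R.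

(* P(C_k = Z/nZ): the k arcs are i.i.d., U uniform on Z/nZ, independent of R *)
Definition covprob (p : nat -> R) (n k : nat) : R :=
  \sum_(a : {ffun 'I_k -> 'I_n * 'I_n})
     ((\prod_(i < k) ((n%:R)^-1 * wlen p (a i).2)) * (covered a)%:R).

(* P(T_n <= t) = P(N(t) >= first covering index)
              = sum_k P(N(t) = k) P(C_k = Z/nZ)   (N independent, C_k increasing) *)
Definition cdfT (p : nat -> R) (n : nat) (t : R) : R :=
  if t < 0 then 0 else
  limn (fun K => \sum_(k < K) (expR (- t) * t ^+ k / (k`!)%:R * covprob p n k)).

Definition cdf_scaled (p : nat -> R) (n : nat) (x : R) : R :=
  cdfT p n (x / tailf p n%:R).

Definition distribution_function (G : R -> R) : Prop :=
  {homo G : x y / x <= y} /\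
  (forall x, G y @[y --> x^'+] --> G x) /\
  G @ -oo --> (0 : R) /\ G @ +oo --> (1 : R).

Definition degenerate_df (G : R -> R) : Prop :=
  exists c : R, forall x, G x = if x < c then 0 else 1.

Definition compact_support_df (G : R -> R) : Prop :=
  exists a b : R, forall x, (x < a -> G x = 0) /\ (b <= x -> G x = 1).

End Covering.

(* Main.v *)
Require Import Defs.
From HB Require Import structures.
From mathcomp Require Import all_boot all_order all_algebra.
From mathcomp Require Import all_classical all_reals all_analysis.
From mathcomp Require Import ring lra zify.
Import Order.TTheory GRing.Theory Num.Theory.
Import numFieldNormedType.Exports.
Local Open Scope classical_set_scope.
Local Open Scope ring_scope.

(** Upper tail. An arc of length at least [n] covers everything, so [f(n) T_n] is stochastically dominated by an exponential variable; this gives tightness, and no limit can be a point mass at [c > 0]. Cut the circle into [K] blocks of length about [n/K]. Regular variation gives [i f(i) >= n f(n) / 4] for [n/K <= i <= n] and [n] large, so at time [b / f(n)] a given block is not inside a single arc with probability at most [(K/2)^(-b/4)]. For [b >= 8] the union bound over the [K] blocks is [4/K], and [K] is arbitrary: the limit is bounded.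

Lower tail. With [S_m = f(1) + ... + f(m)], two points at distance [d] are both uncovered at time [t] with probability [exp (- t (S_d + S_(n-d)) / n)]. The two hypotheses at [beta = 1/2] give [S_n - S_d <= C n f(n) ln (n / max(d,1))], so at [t = 1 / (2 C f(n))] the number [Z] of uncovered points satisfies [E Z^2 <= 6 (E Z)^2]. By the second moment method some point is uncovered with probability at least [1/6], which excludes a point mass at [0]. *)

Set Implicit Arguments.
Unset Strict Implicit.
Unset Printing Implicit Defensive.

(** * The law of one arc and expectations over [k] independent arcs *)

Section Weights.
Variables (R : realType) (p : nat -> R).
Hypothesis pmf : radius_pmf p.

Lemma psum_le1 (m : nat) : \sum_(k < m) p k <= 1.
Proof.
case: pmf => _ [p_ge0 cv].
have nd : {homo (fun N => \sum_(k < N) p k) : i j / (i <= j)%N >-> i <= j}.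
  by apply: homo_leq => [//|y x z|i]; [exact: le_trans|rewrite big_ord_recr lerDl].
rewrite -(cvg_lim (@Rhausdorff R) cv).
by apply: (nondecreasing_cvgn_le nd); apply/cvg_ex; exists 1.
Qed.

(** The branch [x <= 1] of [tailf] fits the same formula: the sum is empty at 0 and equals [p 0 = 0]
    at 1. *)
Lemma tailf_nat (m : nat) : tailf p m%:R = 1 - \sum_(k < m) p k.
Proof.
case: pmf => p0 _; rewrite /tailf lern1.
case: leqP => [|_]; last by rewrite -[m%:R]/(m%:~R) intrKceil.
by case: m => [|[|//]] _; rewrite ?big_ord0 ?subr0// big_ord1 p0 subr0.
Qed.

Lemma tailf_recr (m : nat) : tailf p m%:R = p m + tailf p m.+1%:R.
Proof. by rewrite !tailf_nat big_ord_recr /=; lra. Qed.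

Lemma tailf_antitone (x y : R) : x <= y -> tailf p y <= tailf p x.
Proof.
case: pmf => _ [p_ge0 _] xy; rewrite /tailf.
case: (leP y 1) => y1; first by rewrite (le_trans xy y1).
case: (leP x 1) => x1; first by rewrite gerBl sumr_ge0.
rewrite lerD2l lerN2.
have : (`|Num.ceil x| <= `|Num.ceil y|)%N.
  have := le_ceil xy; have : 0 <= Num.ceil x by rewrite ceil_ge0; lra.
  by lia.
move=> /(big_ord_widen_cond _ predT p) -> /=.
by rewrite big_mkcond; apply: ler_sum => i _; case: ifP.
Qed.

Lemma tailf_ge0 (x : R) : 0 <= tailf p x.
Proof. by rewrite /tailf; case: ifP => // _; rewrite subr_ge0 psum_le1. Qed.

Lemma wlen_ge0 (n : nat) (r : 'I_n) : 0 <= wlen p r.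
Proof.
by case: pmf => _ [p_ge0 _]; rewrite /wlen; case: ifP => // _; exact: tailf_ge0.
Qed.

(** Truncating the radius at [n] does not change the event that it is at least [m], as [m <= n]. The
    induction descends from [m = n], where only the last index counts. *)
Lemma sum_wlen_ge (n m : nat) : (0 < m <= n)%N ->
  \sum_(r < n) wlen p r * (m <= r.+1)%N%:R = tailf p m%:R.
Proof.
case/andP; case: n => [|n]; first by case: m.
move=> m_gt0; rewrite big_ord_recr /= => mn.
rewrite mn mulr1 {2}/wlen /= ltnn.
have -> : \sum_(i < n) wlen p (widen_ord (leqnSn n) i) * (m <= i.+1)%N%:R =
    \sum_(i < n) p i.+1 * (m <= i.+1)%N%:R.
  apply: eq_bigr => i _; have lt_in : (i < n)%N := ltn_ord i.
  by rewrite /wlen /= ltnS lt_in.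
have [j [mE]] : exists j, m = (n.+1 - j)%N /\ (j <= n)%N by exists (n.+1 - m)%N; lia.
rewrite {m m_gt0 mn}mE; elim: j => [_|j IH jn].
  rewrite subn0 big1 ?add0r// => i _.
  have lt_in : (i < n)%N := ltn_ord i.
  by rewrite ltnNge in lt_in; rewrite ltnS (negbTE lt_in) mulr0.
rewrite [RHS]tailf_recr.
have [q [nj njS qn]] : exists q, [/\ n.+1 - j.+1 = q.+1, n.+1 - j = q.+2 & q < n]%N.
  by exists (n - j.+1)%N; split; lia.
rewrite nj -njS -IH; last by lia.
rewrite njS addrA; congr (_ + _).
(* The two indicators differ only at index [q], whose term supplies the extra [p q.+1]. *)
rewrite (bigD1 (Ordinal qn)) //= [in RHS](bigD1 (Ordinal qn)) //=.
rewrite leqnn ltnn mulr1 mulr0 add0r; congr (_ + _).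
apply: eq_bigr => i iq; congr (_ * (nat_of_bool _)%:R).
have : i != q :> nat by [].
by lia.
Qed.

Lemma sum_wlen (n : nat) : (0 < n)%N -> \sum_(r < n) wlen p r = 1.
Proof.
move=> n0; rewrite -[RHS](_ : tailf p 1%:R = 1).
  rewrite -(@sum_wlen_ge n 1) ?n0//.
  by apply: eq_bigr => i _; rewrite mulr1.
by rewrite /tailf lexx.
Qed.

Definition arc_weight n (a : 'I_n * 'I_n) : R := n%:R^-1 * wlen p a.2.

Definition arc_prob n (g : pred ('I_n * 'I_n)) : R :=
  \sum_a arc_weight a * (g a)%:R.

Lemma arc_weight_ge0 n (a : 'I_n * 'I_n) : 0 <= arc_weight a.
Proof. by rewrite mulr_ge0 ?invr_ge0 ?ler0n ?wlen_ge0. Qed.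

Lemma sum_arc_weight n : (0 < n)%N -> \sum_(a : 'I_n * 'I_n) arc_weight a = 1.
Proof.
move=> n0; rewrite -(pair_bigA _ (fun u r => n%:R^-1 * wlen p r)) /=.
under eq_bigr => u _ do rewrite -mulr_sumr sum_wlen// mulr1.
by rewrite sumr_const card_ord -[LHS]mulr_natr mulVf// pnatr_eq0 -lt0n.
Qed.

Lemma arc_probC n (g : pred ('I_n * 'I_n)) : (0 < n)%N ->
  arc_prob (predC g) = 1 - arc_prob g.
Proof.
move=> n0; rewrite -(sum_arc_weight n0) /arc_prob -sumrB.
by apply: eq_bigr => a _ /=; case: (g a); rewrite ?mulr1 ?mulr0; ring.
Qed.

(** Expectation over [k] independent arcs, written so that [covprob] is an instance by
    conversion. *)
Definition arcs_mean n k (h : {ffun 'I_k -> 'I_n * 'I_n} -> R) : R :=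
  \sum_(a : {ffun 'I_k -> 'I_n * 'I_n}) (\prod_(i < k) arc_weight (a i)) * h a.

(** Independence: a sum over functions of a product is a product of sums. The resulting [k]-th
    powers are what Poissonization handles. *)
Lemma arcs_mean_prod n k (g : pred ('I_n * 'I_n)) :
  arcs_mean (fun a : {ffun 'I_k -> _} => \prod_(i < k) (g (a i))%:R) =
  arc_prob g ^+ k.
Proof.
rewrite /arcs_mean.
under eq_bigr => a _ do rewrite -big_split /=.
rewrite -(bigA_distr_bigA (fun (_ : 'I_k) b => arc_weight b * (g b)%:R)) /=.
by rewrite prodr_const card_ord.
Qed.

Lemma arcs_mean1 n k : (0 < n)%N ->
  arcs_mean (fun _ : {ffun 'I_k -> 'I_n * 'I_n} => 1) = 1.
Proof.
move=> n0; have prob1 : arc_prob (predT : pred ('I_n * 'I_n)) = 1.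
  by rewrite -[RHS](sum_arc_weight n0); apply: eq_bigr => a _; rewrite mulr1.
transitivity (arc_prob (predT : pred ('I_n * 'I_n)) ^+ k); last by rewrite prob1 expr1n.
by rewrite -arcs_mean_prod /arcs_mean; apply: eq_bigr => a _; rewrite [X in _ = _ * X]big1.
Qed.

Lemma arcs_mean_le n k (h1 h2 : {ffun 'I_k -> 'I_n * 'I_n} -> R) :
  (forall a, h1 a <= h2 a) -> arcs_mean h1 <= arcs_mean h2.
Proof.
move=> h12; apply: ler_sum => a _; apply: ler_wpM2l => //.
by apply: prodr_ge0 => i _; exact: arc_weight_ge0.
Qed.

Lemma arcs_mean_sum n k (I : Type) (s : seq I)
    (h : I -> {ffun 'I_k -> 'I_n * 'I_n} -> R) :
  arcs_mean (fun a => \sum_(b <- s) h b a) = \sum_(b <- s) arcs_mean (h b).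
Proof.
rewrite /arcs_mean exchange_big /=.
by apply: eq_bigr => a _; rewrite mulr_sumr.
Qed.

Lemma arcs_meanD n k (h1 h2 : {ffun 'I_k -> 'I_n * 'I_n} -> R) :
  arcs_mean (fun a => h1 a + h2 a) = arcs_mean h1 + arcs_mean h2.
Proof. by rewrite /arcs_mean -big_split; apply: eq_bigr => a _; rewrite /= mulrDr. Qed.

Lemma arcs_meanB n k (h1 h2 : {ffun 'I_k -> 'I_n * 'I_n} -> R) :
  arcs_mean (fun a => h1 a - h2 a) = arcs_mean h1 - arcs_mean h2.
Proof. by rewrite /arcs_mean -sumrB; apply: eq_bigr => a _; ring. Qed.

Lemma arcs_meanZ n k (c : R) (h : {ffun 'I_k -> 'I_n * 'I_n} -> R) :
  arcs_mean (fun a => c * h a) = c * arcs_mean h.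
Proof. by rewrite /arcs_mean mulr_sumr; apply: eq_bigr => a _; ring. Qed.

Lemma covprobE n k : covprob p n k =
  arcs_mean (fun a : {ffun 'I_k -> 'I_n * 'I_n} => (covered a)%:R).
Proof. by []. Qed.
End Weights.

(** * Exact probabilities that one arc hits one or two given points *)

Section Arcs.
Variables (R : realType) (p : nat -> R).
Hypothesis pmf : radius_pmf p.

(** The reflection sending [u] to [s - u] modulo [n] is an involution, so the offset of [s] from a
    uniform starting point is uniform. *)
Lemma sum_start (n s : nat) (F : nat -> R) : (0 < n)%N ->
  \sum_(u < n) F ((s + n - u) %% n)%N = \sum_(v < n) F v.
Proof.
move=> n_gt0.
pose flip (u : 'I_n) := Ordinal (ltn_pmod (s + n - u) n_gt0).
have flipK : involutive flip.
  move=> u; apply: val_inj => /=.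
  have u_lt : (u < n)%N := ltn_ord u.
  have v_lt : ((s + n - u) %% n < n)%N by rewrite ltn_mod.
  have := divn_eq (s + n - u) n; move: ((s + n - u) %/ n)%N => q.
  move: (_ %% _)%N v_lt => v v_lt eq_v.
  have -> : (s + n - v = q * n + u)%N by lia.
  by rewrite modnMDl modn_small.
by rewrite [RHS](reindex_inj (inv_inj flipK)).
Qed.

(** The offset [v] of [s] is uniform and independent of the length. Encoded lengths are at most [n],
    so offsets with [h v > n] contribute nothing. *)
Lemma arc_prob_start (n s : nat) (h : nat -> nat) : (0 < n)%N ->
  (forall v, 0 < h v)%N ->
  arc_prob p (fun a : 'I_n * 'I_n => (h ((s + n - a.1) %% n) <= a.2.+1)%N) =
  n%:R^-1 * \sum_(v < n | (h v <= n)%N) tailf p (h v)%:R.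
Proof.
move=> n_gt0 h_gt0; rewrite /arc_prob /arc_weight.
rewrite -(pair_bigA _ (fun (u r : 'I_n) => n%:R^-1 * wlen p r *
  (h ((s + n - u) %% n) <= r.+1)%N%:R)) /=.
pose F v := \sum_(r < n) wlen p r * (h v <= r.+1)%N%:R.
under eq_bigr => u _.
  rewrite (_ : \sum_(r < n) _ = n%:R^-1 * F ((s + n - u) %% n)%N); last first.
    by rewrite mulr_sumr; apply: eq_bigr => r _; rewrite mulrA.
over.
rewrite -mulr_sumr (sum_start s F n_gt0) [in RHS]big_mkcond /=; congr (_ * _).
apply: eq_bigr => v _; case: leqP => hn; first by rewrite /F sum_wlen_ge// h_gt0.
apply: big1 => r _; have r_lt : (r < n)%N := ltn_ord r.
by rewrite leqNgt (leq_ltn_trans r_lt hn) mulr0.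
Qed.

(** Counted from the start of the arc, the run [s, ..., s + m - 1] ends before the arc does. For
    [m = 1] this means that the arc contains [s]; for larger [m] it is only sufficient for
    containing the run, since an arc of length [n] contains every point. *)
Definition reaches n (s m : nat) (a : 'I_n * 'I_n) : bool :=
  ((s + n - a.1) %% n + m <= a.2.+1)%N.

Lemma arc_prob_reaches (n s m : nat) : (0 < n)%N -> (0 < m)%N ->
  arc_prob p (@reaches n s m) =
  n%:R^-1 * \sum_(m <= i < n.+1) tailf p i%:R.
Proof.
move=> n_gt0 m_gt0.
rewrite (@arc_prob_start n s (addn^~ m))//; last by move=> v; rewrite addn_gt0 m_gt0 orbT.
congr (_ * _); case: (leqP m n) => mn; last first.
  rewrite [RHS]big_geq// big1// => v; lia.
rewrite -(big_mkord (fun v => v + m <= n)%N (fun v => tailf p (v + m)%:R)).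
rewrite (@big_cat_nat _ _ _ (n.+1 - m))/=; [|lia..].
rewrite [X in _ + X]big1_seq ?addr0; last first.
  by move=> v; rewrite mem_index_iota; lia.
rewrite -[m in RHS]add0n big_addn big_nat_cond [RHS]big_nat_cond.
by apply: eq_bigl => v; lia.
Qed.

(** This is [S_m], the mean of the radius truncated at [m]. *)
Definition tailsum (m : nat) : R := \sum_(i < m) tailf p i.+1%:R.

Lemma arc_prob_hit (n s : nat) : (0 < n)%N ->
  arc_prob p (@reaches n s 1) = n%:R^-1 * tailsum n.
Proof.
by move=> n_gt0; rewrite arc_prob_reaches// big_add1 /= big_mkord.
Qed.

(** Only the point met first from the start of the arc matters. If [i] has offset [v], then [j] has
    offset [v + d] modulo [n]: [i] comes first for [v < n - d], which gives [S_(n-d)], and [j]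
    otherwise, which gives [S_d]. *)
Lemma arc_prob_hit2 (n i j : nat) : (i < n)%N -> (j < n)%N ->
  let d := ((j + n - i) %% n)%N in
  arc_prob p (fun a : 'I_n * 'I_n => reaches i 1 a || reaches j 1 a) =
  n%:R^-1 * (tailsum d + tailsum (n - d)).
Proof.
move=> i_lt j_lt; have n_gt0 : (0 < n)%N by lia.
set d := (_ %% n)%N; have d_lt : (d < n)%N by rewrite ltn_mod.
pose h v := (minn v ((v + d) %% n)).+1.
transitivity (arc_prob p (fun a : 'I_n * 'I_n => (h ((i + n - a.1) %% n) <= a.2.+1)%N)).
  apply: eq_bigr => -[u r] _; congr (_ * (nat_of_bool _)%:R).
  rewrite /h /reaches /= !addn1 !ltnS geq_min; congr (_ || (_ <= _)%N).
  rewrite /d modnDm -[RHS](modnDr _ n) -[LHS](modnDr _ n).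
  have u_lt : (u < n)%N := ltn_ord u.
  by rewrite -[LHS](modnDr _ n); congr (_ %% _)%N; lia.
rewrite (@arc_prob_start n i h)//; congr (_ * _).
pose F v := tailf p (minn v ((v + d) %% n)).+1%:R.
transitivity (\sum_(0 <= v < n) F v).
  rewrite big_mkord; apply: eq_bigl => v.
  by have v_lt : (v < n)%N := ltn_ord v; rewrite /h; lia.
rewrite (@big_cat_nat _ _ _ (n - d))/=; [|lia..].
rewrite addrC; congr (_ + _).
  rewrite -{1}[(n - d)%N]add0n big_addn.
  rewrite (_ : n - (n - d) = d)%N; last by lia.
  rewrite big_mkord; apply: eq_bigr => v _.
  have v_lt : (v < d)%N := ltn_ord v.
  rewrite /F (_ : v + (n - d) + d = v + n)%N; last by lia.
  rewrite modnDr modn_small; last by lia.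
  by rewrite (minn_idPr _)//; lia.
rewrite big_mkord; apply: eq_bigr => v _.
have v_lt : (v < n - d)%N := ltn_ord v.
rewrite /F modn_small; last by lia.
by rewrite (minn_idPl _)//; lia.
Qed.

Lemma covered_hits n k (a : {ffun 'I_k -> 'I_n * 'I_n}) :
  covered a = [forall j : 'I_n, [exists i : 'I_k, reaches j 1 (a i)]].
Proof.
rewrite /covered /reaches; apply: eq_forallb => j; apply: eq_existsb => i.
by rewrite addn1 ltnS.
Qed.

(** Reducing modulo [n] can only decrease the offset of [s + c]. *)
Lemma reaches_hits n (s m c : nat) (a : 'I_n * 'I_n) : (0 < n)%N ->
  (c < m)%N -> reaches s m a -> reaches (s + c) 1 a.
Proof.
move=> n_gt0 cm; rewrite /reaches.
have u_lt : (a.1 < n)%N := ltn_ord a.1.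
have -> : (s + c + n - a.1 = (s + n - a.1) + c)%N by lia.
have : ((s + n - a.1 + c) %% n <= (s + n - a.1) %% n + c)%N.
  by rewrite -modnDml leq_mod.
lia.
Qed.

End Arcs.

(** * From a fixed number of arcs to Poisson time *)

Section Poissonization.
Variables (R : realType) (p : nat -> R).
Hypothesis pmf : radius_pmf p.

Lemma poisson_gf (t q : R) :
  (fun K => \sum_(k < K) (expR (- t) * t ^+ k / (k`!)%:R * q ^+ k)) @ \oo
    --> expR (- (t * (1 - q))).
Proof.
have -> : - (t * (1 - q)) = - t + t * q by ring.
rewrite expRD.
have -> : (fun K => \sum_(k < K) (expR (- t) * t ^+ k / (k`!)%:R * q ^+ k)) =
    (fun K => expR (- t) * series (exp_coeff (t * q)) K).
  apply/funext => K; rewrite /series /= big_mkord mulr_sumr.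
  by apply: eq_bigr => k _; rewrite /exp_coeff /= exprMn; ring.
by apply: cvgMr; exact: is_cvg_series_exp_coeff.
Qed.

(** The coefficients may be negative, so bounds of inclusion-exclusion type that hold for every
    number of arcs carry over to Poisson time. *)
Lemma poisson_gf_sum (I : finType) (c q : I -> R) (t : R) :
  (fun K => \sum_(k < K) (expR (- t) * t ^+ k / (k`!)%:R *
     \sum_b c b * q b ^+ k)) @ \oo
    --> \sum_b c b * expR (- (t * (1 - q b))).
Proof.
have -> : (fun K => \sum_(k < K) (expR (- t) * t ^+ k / (k`!)%:R *
     \sum_b c b * q b ^+ k)) =
  (fun K => \sum_b c b * \sum_(k < K) (expR (- t) * t ^+ k / (k`!)%:R * q b ^+ k)).
  apply/funext => K; under eq_bigr do rewrite mulr_sumr.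
  rewrite exchange_big /=; apply: eq_bigr => b _; rewrite mulr_sumr.
  by apply: eq_bigr => k _; ring.
apply: cvg_big => [|b _]; first exact: add_continuous.
by apply: cvgMr; exact: poisson_gf.
Qed.

Lemma covprob_bounds n k : (0 < n)%N -> 0 <= covprob p n k <= 1.
Proof.
move=> n0; rewrite covprobE; apply/andP; split.
  apply: sumr_ge0 => a _; rewrite mulr_ge0 ?ler0n// prodr_ge0// => i _.
  exact: arc_weight_ge0.
rewrite -[X in _ <= X](@arcs_mean1 _ p pmf n k n0); apply: arcs_mean_le => // a.
by rewrite lern1 leq_b1.
Qed.

Lemma poisson_pmf_ge0 (t : R) k : 0 <= t -> 0 <= expR (- t) * t ^+ k / (k`!)%:R.
Proof. by move=> t0; rewrite !mulr_ge0 ?expR_ge0 ?exprn_ge0 ?invr_ge0 ?ler0n. Qed.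

(** A value of [limn] is informative only with convergence. The partial sums increase and are
    bounded by the total Poisson mass, which is [poisson_gf] at [q = 1]. *)
Lemma cdfT_cvg n (t : R) : (0 < n)%N -> 0 <= t ->
  (fun K => \sum_(k < K) (expR (- t) * t ^+ k / (k`!)%:R * covprob p n k)) @ \oo
    --> cdfT p n t.
Proof.
move=> n0 t0; rewrite /cdfT ltNge t0 /=.
have term_ge0 k : 0 <= expR (- t) * t ^+ k / (k`!)%:R * covprob p n k.
  by rewrite mulr_ge0 ?poisson_pmf_ge0//; case/andP: (covprob_bounds k n0).
have := @poisson_gf t 1; rewrite subrr mulr0 oppr0 expR0 => mass.
apply: nondecreasing_is_cvgn.
  by apply: homo_leq => [//|y x z|K]; [exact: le_trans|rewrite big_ord_recr lerDl].
exists 1 => _ [K _ <-].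
have nd : {homo (fun N => \sum_(k < N) (expR (- t) * t ^+ k / (k`!)%:R * 1 ^+ k))
     : i j / (i <= j)%N >-> i <= j}.
  apply: homo_leq => [//|y x z|i]; first exact: le_trans.
  by rewrite big_ord_recr lerDl expr1n mulr1 poisson_pmf_ge0.
apply: (@le_trans _ _ (\sum_(k < K) (expR (- t) * t ^+ k / (k`!)%:R * 1 ^+ k))).
  apply: ler_sum => k _; rewrite expr1n ler_wpM2l ?poisson_pmf_ge0//.
  by case/andP: (covprob_bounds k n0).
rewrite -[leRHS](cvg_lim (@Rhausdorff R) mass).
by apply: (nondecreasing_cvgn_le nd); apply/cvg_ex; exists 1.
Qed.

Lemma cdfT_ge (I : finType) (c q : I -> R) n (t : R) : (0 < n)%N -> 0 <= t ->
  (forall k, \sum_b c b * q b ^+ k <= covprob p n k) ->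
  \sum_b c b * expR (- (t * (1 - q b))) <= cdfT p n t.
Proof.
move=> n0 t0 lb; apply: (ler_cvg_to (@poisson_gf_sum I c q t) (@cdfT_cvg n t n0 t0)).
apply: nearW => K; apply: ler_sum => k _.
by rewrite ler_wpM2l ?poisson_pmf_ge0.
Qed.

Lemma cdfT_le (I : finType) (c q : I -> R) n (t : R) : (0 < n)%N -> 0 <= t ->
  (forall k, covprob p n k <= \sum_b c b * q b ^+ k) ->
  cdfT p n t <= \sum_b c b * expR (- (t * (1 - q b))).
Proof.
move=> n0 t0 ub; apply: (ler_cvg_to (@cdfT_cvg n t n0 t0) (@poisson_gf_sum I c q t)).
apply: nearW => K; apply: ler_sum => k _.
by rewrite ler_wpM2l ?poisson_pmf_ge0.
Qed.

Lemma prod_natb k (g : pred 'I_k) :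
  \prod_(i < k) (g i)%:R = [forall i, g i]%:R :> R.
Proof.
case: forallP => [all_g|/existsNP[i /negP gi]].
  by rewrite big1// => i _; rewrite all_g.
by rewrite (bigD1 i)//= (negbTE gi) mul0r.
Qed.

(** Arcs of type [g b] arrive at rate [arc_prob p (g b)], hence the exponentials; coverage can fail
    only if some type is absent. *)
Lemma cdfT_union_bound (I : finType) n (g : I -> pred ('I_n * 'I_n)) (t : R) :
  (0 < n)%N -> 0 <= t ->
  (forall k (a : {ffun 'I_k -> 'I_n * 'I_n}),
     (forall b, exists i, g b (a i)) -> covered a) ->
  1 - \sum_b expR (- (t * arc_prob p (g b))) <= cdfT p n t.
Proof.
move=> n0 t0 cov.
(* The summand ['I_1] carries the constant 1, seen as [1 ^+ k]. *)
pose c (b : 'I_1 + I) : R := if b is inr _ then -1 else 1.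
pose q (b : 'I_1 + I) : R := if b is inr b then arc_prob p (predC (g b)) else 1.
have split (F : R -> R) : \sum_b c b * F (q b) =
    F 1 - \sum_b F (arc_prob p (predC (g b))).
  rewrite big_sumType /= big_ord1 /= mul1r -sumrN; congr (_ + _).
  by apply: eq_bigr => b _; rewrite mulN1r.
have := @cdfT_ge _ c q n t n0 t0.
rewrite (split (fun x => expR (- (t * (1 - x))))) subrr mulr0 oppr0 expR0.
rewrite (eq_bigr (fun b => expR (- (t * arc_prob p (g b))))); last first.
  by move=> b _; rewrite arc_probC// opprB addrCA subrr addr0.
apply => k; rewrite (split (fun x => x ^+ k)) expr1n.
under eq_bigr do rewrite -arcs_mean_prod.
rewrite -arcs_mean_sum -[X in X - _](@arcs_mean1 _ p pmf n k n0) -arcs_meanB covprobE; apply: arcs_mean_le => // a.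
under eq_bigr do rewrite prod_natb.
have sum_ge0 : 0 <= \sum_b [forall i, predC (g b) (a i)]%:R :> R.
  by apply: sumr_ge0 => b _; rewrite ler0n.
case covE : (covered a); first by rewrite gerBl.
rewrite subr_le0.
have [b /forallP nb] : exists b, [forall i, predC (g b) (a i)].
  apply/not_existsP => no; move/negP: covE; apply; apply: cov => b.
  have /negP := no b; rewrite negb_forall => /existsP[i].
  by rewrite negbK => gi; exists i.
rewrite (bigD1 b)//= (introT forallP nb) lerDl.
by apply: sumr_ge0 => b' _; rewrite ler0n.
Qed.

(* Second moment method, linearized as [Z > 0] >= 2 l Z - (l Z)^2 so that it commutes with Poissonization. *)
Lemma cdfT_second_moment n (t l : R) : (0 < n)%N -> 0 <= t ->
  cdfT p n t <= 1
    - 2 * l * (\sum_(j < n) expR (- (t * arc_prob p (@reaches n j 1))))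
    + l ^+ 2 * \sum_(i < n) \sum_(j < n)
        expR (- (t * arc_prob p
          (fun a : 'I_n * 'I_n => reaches i 1 a || reaches j 1 a))).
Proof.
move=> n0 t0.
pose g2 (ij : 'I_n * 'I_n) : pred ('I_n * 'I_n) :=
  fun a => reaches ij.1 1 a || reaches ij.2 1 a.
pose g1 (j : 'I_n) : pred ('I_n * 'I_n) := fun a => reaches j 1 a.
pose c (b : 'I_1 + ('I_n + 'I_n * 'I_n)) : R :=
  match b with inl _ => 1 | inr (inl _) => - (2 * l) | inr (inr _) => l ^+ 2 end.
pose q (b : 'I_1 + ('I_n + 'I_n * 'I_n)) : R :=
  match b with inl _ => 1 | inr (inl j) => arc_prob p (predC (g1 j))
  | inr (inr ij) => arc_prob p (predC (g2 ij)) end.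
have split (F : R -> R) : \sum_b c b * F (q b) =
    F 1 - 2 * l * (\sum_j F (arc_prob p (predC (g1 j))))
    + l ^+ 2 * \sum_ij F (arc_prob p (predC (g2 ij))).
  rewrite big_sumType /= big_ord1 mul1r big_sumType /= addrA; congr (_ + _ + _).
    by rewrite mulr_sumr -sumrN; apply: eq_bigr => b _; rewrite mulNr.
  by rewrite mulr_sumr.
have := @cdfT_le _ c q n t n0 t0.
rewrite (split (fun x => expR (- (t * (1 - x))))) subrr mulr0 oppr0 expR0.
rewrite (eq_bigr (fun b => expR (- (t * arc_prob p (g1 b))))); last first.
  by move=> b _; rewrite arc_probC// opprB addrCA subrr addr0.
rewrite (eq_bigr (fun b => expR (- (t * arc_prob p (g2 b))))); last first.
  by move=> b _; rewrite arc_probC// opprB addrCA subrr addr0.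
rewrite [X in _ -> _ <= _ - _ + _ * X]pair_bigA /=; apply => k.
rewrite (split (fun x => x ^+ k)) expr1n.
under eq_bigr do rewrite -arcs_mean_prod.
under [X in _ <= _ + _ * X]eq_bigr do rewrite -arcs_mean_prod.
rewrite -!arcs_mean_sum -!arcs_meanZ -[X in X - _ + _](@arcs_mean1 _ p pmf n k n0) -arcs_meanB -arcs_meanD covprobE.
apply: arcs_mean_le => // a.
pose miss (j : 'I_n) : bool := [forall i, ~~ g1 j (a i)].
pose Z : R := \sum_(j < n) (miss j)%:R.
have -> : \sum_(j < n) \prod_(i < k) (predC (g1 j) (a i))%:R = Z.
  by apply: eq_bigr => j _; rewrite prod_natb.
(* Expanding the square counts ordered pairs of uncovered points. *)
have -> : \sum_ij \prod_(i < k) (predC (g2 ij) (a i))%:R = Z ^+ 2.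
  rewrite expr2 /Z big_distrlr /= pair_bigA /=; apply: eq_bigr => ij _.
  rewrite prod_natb -natrM mulnb; congr (nat_of_bool _)%:R.
  apply/forallP/andP => [no|[/forallP no1 /forallP no2] i].
    by split; apply/forallP => i; have := no i; rewrite /= negb_or => /andP[].
  by rewrite /= negb_or no1 no2.
(* If some point is uncovered, the right side is the square of [1 - l * Z]; if none is, [Z = 0] and
   both sides are 1. *)
case covE : (covered a); last first.
  have -> : 1 - 2 * l * Z + l ^+ 2 * Z ^+ 2 = (1 - l * Z) ^+ 2 by ring.
  exact: sqr_ge0.
have -> : Z = 0; last by rewrite expr0n /= !mulr0 subr0 addr0.
apply: big1 => j _; move: covE; rewrite covered_hits => /forallP/(_ j)/existsP[i hit].
by case: (@idP (miss j)) => // /forallP/(_ i); rewrite /g1 hit.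
Qed.
End Poissonization.

(** * Elementary comparisons of sums with logarithms and square roots *)

Lemma sum_inv_ge_ln (R : realType) (m n : nat) : (0 < m)%N -> (m <= n)%N ->
  ln (n%:R : R) - ln m%:R <= \sum_(m <= i < n) i%:R^-1.
Proof.
move=> m_gt0 mn; rewrite -(subnK mn) addnC.
elim: (n - m)%N => [|d IH]; first by rewrite addn0 big_geq// subrr.
rewrite addnS big_nat_recr ?leq_addr//=.
apply: le_trans _ (lerD IH (lexx _)).
set k := (m + d)%N; have k_gt0 : (0 < k%:R :> R) by rewrite ltr0n addn_gt0 m_gt0.
rewrite addrAC lerD2r -lerBlDl -ln_div ?posrE ?k_gt0 ?ltr0n//.
rewrite -[k.+1]addn1 natrD mulrDl divff ?gt_eqF// mul1r.
by apply: le_ln1Dx; rewrite (@lt_trans _ _ 0) ?invr_gt0// ltrN10.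
Qed.

(** Like the previous bound, this telescopes [ln (1 + x) <= x], here at [x = - 1 / (k + 1)] instead
    of [x = 1 / k]. *)
Lemma sum_inv_le_ln (R : realType) (m n : nat) : (0 < m)%N -> (m <= n)%N ->
  \sum_(m <= i < n) (i.+1%:R : R)^-1 <= ln n%:R - ln m%:R.
Proof.
move=> m_gt0 mn; rewrite -(subnK mn) addnC.
elim: (n - m)%N => [|d IH]; first by rewrite addn0 big_geq// subrr.
rewrite addnS big_nat_recr ?leq_addr//=.
apply: le_trans (lerD IH (lexx _)) _.
set k := (m + d)%N; have k_gt0 : (0 < k%:R :> R) by rewrite ltr0n addn_gt0 m_gt0.
have kS_gt0 : (0 < k.+1%:R :> R) by rewrite ltr0n.
rewrite addrAC lerD2r -lerBrDl -[leLHS]opprK -[leRHS]opprB lerN2.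
rewrite -ln_div ?posrE// (_ : k%:R / k.+1%:R = 1 + - k.+1%:R^-1); last first.
  by rewrite -[k.+1]addn1 natrD; field; rewrite -natr1 in kS_gt0; rewrite gt_eqF.
by apply: le_ln1Dx; rewrite ltrN2 invf_lt1// ltr1n ltnS -(ltr0n R).
Qed.

(** With [a] and [b] the roots of [n] and [n + 1], the induction step [1 / b <= 2 (b - a)] becomes
    [0 <= (b - a)^2] through [b^2 - a^2 = 1]. *)
Lemma sum_inv_sqrt_le (R : realType) (n : nat) :
  \sum_(d < n) (Num.sqrt (d.+1%:R : R))^-1 <= 2 * Num.sqrt n%:R.
Proof.
elim: n => [|n IH]; first by rewrite big_ord0 sqrtr0 mulr0.
rewrite big_ord_recr /=; apply: le_trans (lerD IH (lexx _)) _.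
have b0 : 0 < Num.sqrt (n.+1%:R : R) by rewrite sqrtr_gt0 ltr0n.
have a0 : 0 <= Num.sqrt (n%:R : R) by exact: sqrtr_ge0.
have : Num.sqrt (n%:R : R) ^+ 2 + 1 = Num.sqrt (n.+1%:R : R) ^+ 2.
  by rewrite !sqr_sqrtr ?ler0n// natr1.
move: (Num.sqrt n%:R) (Num.sqrt n.+1%:R) b0 a0 => a b b0 a0 ab.
rewrite -(ler_pM2r b0) mulrDl mulVf ?gt_eqF//.
by nra.
Qed.

(** * Regular variation and lower bounds on the scaled distribution function *)

Section Tail.
Variables (R : realType) (p : nat -> R).
Hypotheses (pmf : radius_pmf p) (rv : regvar (tailf p) (-1)).

Lemma tailf_ratio_cvg (t : R) : 0 < t ->
  tailf p (n%:R * t) / tailf p n%:R @[n --> \oo] --> t^-1.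
Proof.
move=> t0; case: rv => _ [_ /(_ t t0)]; rewrite powR_inv1 ?ltW//.
by move/cvg_pinftyP; apply; exact: cvgr_idn.
Qed.

(** A zero of [f] would persist to its right and, as the inverse of 0 is 0, make the ratio at
    [t = 1] vanish eventually, although its limit is 1. *)
Lemma tailf_gt0 (x : R) : 0 < tailf p x.
Proof.
rewrite lt_neqAle tailf_ge0// andbT eq_sym; apply/eqP => fx0.
have tail0 (y : R) : x <= y -> tailf p y = 0.
  by move=> xy; apply/le_anti; rewrite tailf_ge0// -[X in _ <= X]fx0 tailf_antitone.
have := tailf_ratio_cvg ltr01; rewrite invr1 => /cvgr_gt/(_ 0 ltr01) ratio.
have [n [/= + xn]] := filter_ex (filterI ratio (nbhs_infty_ger x)).
by rewrite (tail0 _ xn) invr0 mulr0 ltxx.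
Qed.

(** The union bound with a single type, the arcs of length at least [n]: they arrive at rate [f(n)],
    and one of them suffices. *)
Lemma scaled_cdf_ge_exp (n : nat) (x : R) : (0 < n)%N -> 0 <= x ->
  0 < tailf p n%:R -> 1 - expR (- x) <= cdf_scaled p n x.
Proof.
move=> n0 x0 f0; rewrite /cdf_scaled.
have t0 : 0 <= x / tailf p n%:R by rewrite divr_ge0// ltW.
apply: le_trans (@cdfT_union_bound _ p pmf 'I_1 n (fun _ a => (n <= a.2.+1)%N) _ n0 t0 _).
  rewrite big_ord1 (@arc_prob_start _ p pmf n 0 (fun=> n))// leqnn.
  rewrite sumr_const card_ord -[tailf p n%:R *+ n]mulr_natl.
  by rewrite mulKf ?pnatr_eq0 -?lt0n// divfK// gt_eqF.
move=> k a /(_ ord0) [i long]; apply/forallP => j; apply/existsP; exists i.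
by rewrite -ltnS; apply: leq_trans long; rewrite ltn_mod.
Qed.

(** Pointwise convergence on the finite grid [(k + 1) / K] suffices, because [f] is monotone between
    grid points. One factor 2 comes from taking half the limit, the other from rounding
    [i K / n >= 1] up to [k + 1]. *)
Lemma tail_lower_bound (K : nat) : (0 < K)%N ->
  \forall n \near \oo, forall i, (0 < i)%N -> (n <= i * K)%N -> (i <= n)%N ->
    n%:R * tailf p n%:R <= 4 * (i%:R * tailf p i%:R).
Proof.
move=> K_gt0.
have : \forall n \near \oo, forall k : 'I_K.+1,
    (K%:R / (2 * k.+1%:R)) * tailf p n%:R <= tailf p (n%:R * (k.+1%:R / K%:R)).
  apply: filter_forall => k.
  have t0 : 0 < k.+1%:R / K%:R :> R by rewrite divr_gt0 ?ltr0n.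
  have := tailf_ratio_cvg t0; rewrite invf_div => /cvgr_gt.
  move=> /(_ (K%:R / (2 * k.+1%:R))); rewrite [_ < _](_ : _ = true); last first.
    by rewrite ltr_pM2l ?ltr0n// ltf_pV2 ?posrE ?mulr_gt0 ?ltr0n// ltr_pMl ?ltr1n// ltr0n.
  move=> /(_ isT); apply: filterS => n /ltW.
  by rewrite ler_pdivlMr ?tailf_gt0.
apply: filterS => n low i i_gt0 niK le_in.
have [->|ni] := eqVneq i n.
  by have := mulr_ge0 (ler0n R n) (ltW (tailf_gt0 n%:R)); lra.
have k_lt : ((i * K) %/ n < K.+1)%N.
  by rewrite ltnS -[X in (_ <= X)%N](@mulKn _ n) ?leq_div2r ?leq_mul2r ?le_in ?orbT//; lia.
have := low (Ordinal k_lt); rewrite /=.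
have := leq_trunc_div (i * K) n; have := @ltn_ceil (i * K) n.
set k := (_ %/ _)%N => /(_ _) ik1 ik2 lowk.
have {}ik1 : (i * K < k.+1 * n)%N by apply: ik1; lia.
have K0 : 0 < K%:R :> R by rewrite ltr0n.
have n0 : 0 < n%:R :> R by rewrite ltr0n; lia.
have k0 : 0 < k.+1%:R :> R by rewrite ltr0n.
have i0 : 0 < i%:R :> R by rewrite ltr0n.
have fi : tailf p (n%:R * (k.+1%:R / K%:R)) <= tailf p i%:R.
  apply: tailf_antitone => //; rewrite mulrA ler_pdivlMr// -!natrM ler_nat.
  by rewrite [(n * _)%N]mulnC ltnW.
have {fi}lowi := le_trans lowk fi.
have kn : k.+1%:R * n%:R <= 2 * (i%:R * K%:R) :> R.
  by rewrite -!natrM ler_nat mulSn; lia.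
have fn := tailf_gt0 n%:R.
have step : (K%:R / (2 * k.+1%:R)) * tailf p n%:R * (2 * k.+1%:R * n%:R) <=
    tailf p i%:R * (2 * k.+1%:R * n%:R) by rewrite ler_pM2r// !mulr_gt0.
have step2 : (K%:R / (2 * k.+1%:R)) * tailf p n%:R * (2 * k.+1%:R * n%:R) =
    K%:R * (n%:R * tailf p n%:R) by field; rewrite gt_eqF.
rewrite -(ler_pM2l K0) -step2; apply: le_trans step _.
have -> : tailf p i%:R * (2 * k.+1%:R * n%:R) = (k.+1%:R * n%:R) * (2 * tailf p i%:R) by ring.
have -> : K%:R * (4 * (i%:R * tailf p i%:R)) =
  (2 * (i%:R * K%:R)) * (2 * tailf p i%:R) by ring.
by rewrite ler_pM2r// mulr_gt0// tailf_gt0.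
Qed.

Lemma scaled_cdf_ge_blocks (K : nat) (b : R) : (2 <= K)%N -> 8 <= b ->
  \forall n \near \oo, 1 - 4 / K%:R <= cdf_scaled p n b.
Proof.
move=> K2 b8; have K_gt0 : (0 < K)%N by lia.
have K0 : 0 < K%:R :> R by rewrite ltr0n.
near=> n.
have n_ge : (K <= n)%N by near: n; exists K.
have low : forall i, (0 < i)%N -> (n <= i * K)%N -> (i <= n)%N ->
    n%:R * tailf p n%:R <= 4 * (i%:R * tailf p i%:R).
  by near: n; exact: tail_lower_bound.
have n_gt0 : (0 < n)%N by lia.
have n0 : 0 < n%:R :> R by rewrite ltr0n.
have fn := tailf_gt0 n%:R.
have t0 : 0 <= b / tailf p n%:R by rewrite divr_ge0// ltW//; lra.
(* The block length: [n < m * K] makes [K] blocks enough, and [m * K <= 2 * n] gives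
   [n / m >= K / 2], the source of [ln (K / 2)]. *)
pose m := (n %/ K).+1.
have mK1 : (n < m * K)%N by rewrite ltn_ceil.
have mK2 : (m * K <= 2 * n)%N by have := leq_trunc_div n K; rewrite /m mulSn; lia.
have mn : (m <= n)%N.
  by rewrite /m -(leq_pmul2r K_gt0); apply: leq_trans mK2 _; rewrite mulnC leq_mul2l K2 orbT.
apply: le_trans (@cdfT_union_bound _ p pmf 'I_K n (fun c => @reaches n (c * m) m) _ n_gt0 t0 _);
  last first.
  move=> k a blocks; rewrite covered_hits; apply/forallP => j; apply/existsP.
  have jn : (j < n)%N := ltn_ord j.
  have jK : (j %/ m < K)%N by rewrite ltn_divLR//; lia.
  have [i hit] := blocks (Ordinal jK); exists i.
  by rewrite (divn_eq j m); apply: reaches_hits hit => //; rewrite ltn_mod.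
under eq_bigr => c _ do rewrite arc_prob_reaches//.
rewrite sumr_const card_ord lerD2l lerN2 -[X in X <= _]mulr_natl.
set S := \sum_(m <= i < n.+1) _.
have Sge : n%:R * tailf p n%:R / 4 * ln (K%:R / 2) <= S.
  apply: (@le_trans _ _ (\sum_(m <= i < n.+1) n%:R * tailf p n%:R / 4 * i%:R^-1)).
    rewrite -mulr_sumr; apply: ler_wpM2l; first by rewrite divr_ge0 ?mulr_ge0 // ltW.
    apply: le_trans _ (@sum_inv_ge_ln R m n.+1 isT (leqW mn)).
    rewrite -ln_div ?posrE ?ltr0n// ler_ln ?posrE ?divr_gt0 ?ltr0n//.
    rewrite ler_pdivrMr// mulrAC ler_pdivlMr ?ltr0n// -!natrM ler_nat mulnC.
    by apply: leq_trans mK2 _; rewrite mulnC leq_mul2r leqnSn orbT.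
  rewrite big_nat_cond [leRHS]big_nat_cond; apply: ler_sum => i.
  rewrite andbT => /andP[mi i_lt].
  have i_gt0 : (0 < i)%N by apply: leq_trans mi.
  rewrite ler_pdivrMr ?ltr0n// ler_pdivrMr// [leRHS]mulrC [_ * i%:R]mulrC.
  have niK : (n <= i * K)%N by apply: ltnW; apply: leq_trans mK1 _; rewrite leq_mul2r mi orbT.
  by have := low i i_gt0 niK i_lt; lra.
(* Here [b >= 8] absorbs the 4 and leaves exponent 2: each block fails with probability at most
   [(2 / K)^2]. *)
have eS : b / tailf p n%:R * (n%:R^-1 * S) >= 2 * ln (K%:R / 2).
  have -> : b / tailf p n%:R * (n%:R^-1 * S) = b * (S / (n%:R * tailf p n%:R)).
    by field; rewrite !gt_eqF.
  have lnK : 0 <= ln (K%:R / 2 : R).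
    by rewrite ln_ge0// ler_pdivlMr ?ltr0n// mul1r ler_nat.
  have : ln (K%:R / 2) / 4 <= S / (n%:R * tailf p n%:R).
    by rewrite ler_pdivlMr ?mulr_gt0//; lra.
  by nra.
have : expR (- (b / tailf p n%:R * (n%:R^-1 * S))) <= expR (- (2 * ln (K%:R / 2))).
  by rewrite ler_expR lerN2.
have -> : - (2 * ln (K%:R / 2)) = - (ln (K%:R / 2) + ln (K%:R / 2)) :> R by ring.
rewrite [expR (- (ln _ + _))]expRN expRD lnK ?posrE ?divr_gt0 ?ltr0n// => le_e.
apply: le_trans (ler_wpM2l (ltW K0) le_e) _.
by rewrite le_eqVlt; apply/orP; left; apply/eqP; field; rewrite gt_eqF.
Unshelve. all: by end_near. Qed.
End Tail.

(** * The second moment estimate and an upper bound on the scaled distribution function *)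

Section SecondMoment.
Variables (R : realType) (p : nat -> R).
Hypotheses (pmf : radius_pmf p) (rv : regvar (tailf p) (-1)).

Lemma tailsum_ge0 (m : nat) : 0 <= tailsum p m.
Proof. by apply: sumr_ge0 => i _; exact: tailf_ge0. Qed.

Lemma tailsumB (d n : nat) : (d <= n)%N ->
  tailsum p n - tailsum p d = \sum_(d <= i < n) tailf p i.+1%:R.
Proof.
move=> dn; rewrite /tailsum -!(big_mkord predT (fun i => tailf p i.+1%:R)).
by rewrite (@big_cat_nat _ _ _ d 0 n)//= addrAC subrr add0r.
Qed.

(** Above the root of [n], the first hypothesis bounds [f(i)] by a multiple of [n f(n) / i], and the
    sum is logarithmic. Below it, the second hypothesis bounds the remaining sum by a multiple of
    [n f(n) ln n], while the logarithmic gap is at least [(ln n) / 2]; hence the factor 2 in [C].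
    The term [maxn d 1] avoids [ln 0]. *)
Lemma tailsum_gap (B D : R) (N1 N2 : nat) :
  (forall n : nat, (N1 <= n)%N -> forall x : R, (n%:R) `^ 2^-1 <= x <= n%:R ->
     x * tailf p x <= B * (n%:R * tailf p n%:R)) ->
  (forall n : nat, (N2 <= n)%N ->
     \sum_(1 <= i < `|Num.floor ((n%:R) `^ 2^-1 : R)|%N.+1) tailf p i%:R
       <= D * (tailf p n%:R * n%:R * ln (n%:R))) ->
  exists2 C : R, 0 < C & \forall n \near \oo, forall d : nat, (d <= n)%N ->
    tailsum p n - tailsum p d <=
      C * (n%:R * tailf p n%:R) * (ln n%:R - ln (maxn d 1)%:R).
Proof.
move=> hB hD; exists (2 * (`|B| + `|D| + 1)).
  by have := normr_ge0 B; have := normr_ge0 D; lra.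
near=> n => d dn.
have n_gt0 : (0 < n)%N by near: n; exists 1%N.
have n_N1 : (N1 <= n)%N by near: n; exists N1.
have n_N2 : (N2 <= n)%N by near: n; exists N2.
have n1 : 1 <= n%:R :> R by rewrite ler1n.
have n0 : 0 < n%:R :> R by rewrite ltr0n.
have fn := tailf_gt0 pmf rv n%:R.
set L := n%:R * tailf p n%:R.
have L0 : 0 < L by rewrite mulr_gt0.
have lnn : 0 <= ln n%:R :> R by rewrite ln_ge0.
have [B0 D0] : 0 <= `|B| /\ 0 <= `|D| by [].
have BL i : n%:R `^ 2^-1 <= i%:R :> R -> (i <= n)%N -> i%:R * tailf p i%:R <= `|B| * L.
  move=> ni i_le; apply: le_trans (hB n n_N1 i%:R _) _; first by rewrite ni ler_nat.
  by rewrite ler_pM2r// ler_norm.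
(* The condition bears on [e.+1], the first argument of [f] in the sum, so that [e] may be the floor
   of the root. *)
have upper e : (0 < e)%N -> (e <= n)%N -> n%:R `^ 2^-1 <= e.+1%:R :> R ->
    tailsum p n - tailsum p e <= `|B| * L * (ln n%:R - ln e%:R).
  move=> e_gt0 en ne; rewrite tailsumB//.
  apply: le_trans _ (ler_wpM2l _ (@sum_inv_le_ln R e n e_gt0 en)); last first.
    by rewrite mulr_ge0// ltW.
  rewrite mulr_sumr big_nat_cond [leRHS]big_nat_cond; apply: ler_sum => i.
  rewrite andbT => /andP[ei i_lt].
  rewrite ler_pdivlMr ?ltr0n// mulrC; apply: BL => //.
  by apply: le_trans ne _; rewrite ler_nat.
have root1 : 1 <= n%:R `^ 2^-1 :> R by rewrite powR12_sqrt// -[leLHS]sqrtr1 ler_sqrt.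
have lnroot : ln (n%:R `^ 2^-1) = 2^-1 * ln n%:R :> R by rewrite ln_powR.
have root0 : 0 < n%:R `^ 2^-1 :> R by lra.
set s := n%:R `^ 2^-1 in hD BL upper root1 lnroot root0 *.
case: (leP s d%:R) => sd.
  have d_gt0 : (0 < d)%N by rewrite -(ltr0n R); lra.
  have -> : maxn d 1 = d by apply/maxn_idPl.
  have gap0 : 0 <= ln n%:R - ln d%:R :> R.
    by rewrite subr_ge0 ler_ln ?posrE ?ltr0n// ler_nat.
  apply: le_trans (upper d d_gt0 dn _) _.
    by apply: le_trans sd _; rewrite ler_nat.
  apply: ler_wpM2r => //; apply: ler_wpM2r; first exact: ltW.
  by lra.
set m := `|Num.floor s|%N.
have fl0 : 0 <= Num.floor s by rewrite floor_ge0 ltW.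
have ms : m%:R <= s.
  by rewrite /m natr_absz ger0_norm// floor_le_tmp.
have sm : s < m.+1%:R.
  by rewrite /m -natr1 natr_absz ger0_norm// -intrD1 floorD1_gt.
have m_gt0 : (0 < m)%N by rewrite -ltnS -(ltr_nat R); apply: le_lt_trans sm.
have mn : (m <= n)%N.
  rewrite -(ler_nat R); apply: le_trans ms _.
  rewrite /s -[leRHS]powRr1; last exact: ltW.
  by apply: ler_powR => //; lra.
have Sm : tailsum p m <= `|D| * L * ln n%:R.
  have := hD n n_N2; rewrite -/m big_add1 /= big_mkord => /le_trans; apply.
  rewrite [tailf p _ * _]mulrC -/L mulrA; apply: ler_wpM2r => //.
  by rewrite ler_pM2r// ler_norm.
have Sn : tailsum p n - tailsum p m <= `|B| * L * ln n%:R.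
  apply: le_trans (upper m m_gt0 mn (ltW sm)) _.
  apply: ler_wpM2l; first by rewrite mulr_ge0// ltW.
  by rewrite gerBl ln_ge0// ler1n.
have Sd := tailsum_ge0 d.
have lnd : ln (maxn d 1)%:R <= 2^-1 * ln n%:R :> R.
  have max0 : 0 < (maxn d 1)%:R :> R by rewrite ltr0n leq_max orbT.
  rewrite -lnroot ler_ln ?posrE//.
  by case: (leqP d 1) => _; [exact: root1|exact: ltW].
have LL : 0 <= L * ln n%:R by rewrite mulr_ge0// ltW.
apply: (@le_trans _ _ ((`|B| + `|D| + 1) * L * ln n%:R)); first by nra.
have -> : (`|B| + `|D| + 1) * L * ln n%:R =
  2 * (`|B| + `|D| + 1) * L * (2^-1 * ln n%:R) by field.
by apply: ler_wpM2l; [rewrite !mulr_ge0 ?ltW//; lra|lra].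
Unshelve. all: by end_near. Qed.

Lemma expR_half_ln (y : R) : 0 < y -> expR (2^-1 * ln y) = Num.sqrt y.
Proof. by move=> y0; rewrite -powR12_sqrt ?ltW// /powR gt_eqF. Qed.

(** With [a = maxn d 1] and [b = n - d], the left side is [n / sqrt (a b)], and [n <= a + b] gives
    [sqrt n <= sqrt a + sqrt b]. Then [d + 1 <= 4 a] removes the maximum. *)
Lemma expR_gap_le (n d : nat) : (d < n)%N ->
  expR (2^-1 * ((ln n%:R - ln (maxn d 1)%:R) + (ln n%:R - ln (n - d)%:R)))
  <= Num.sqrt n%:R * (2 * (Num.sqrt d.+1%:R)^-1 + (Num.sqrt (n - d)%:R)^-1) :> R.
Proof.
move=> dn; set a := maxn d 1; set b := (n - d)%N.
have a0 : 0 < a%:R :> R by rewrite ltr0n /a; lia.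
have b0 : 0 < b%:R :> R by rewrite ltr0n /b; lia.
have n0 : 0 < n%:R :> R by rewrite ltr0n; lia.
have sd0 : 0 < Num.sqrt d.+1%:R :> R by rewrite sqrtr_gt0 ltr0n.
have nab : n%:R <= a%:R + b%:R :> R by rewrite -natrD ler_nat /a /b; lia.
have d4a : d.+1%:R <= 4 * a%:R :> R by rewrite -natrM ler_nat /a; lia.
rewrite mulrDr expRD !mulrBr !expRD !expRN !expR_half_ln//.
have : Num.sqrt a%:R ^+ 2 + Num.sqrt b%:R ^+ 2 >= Num.sqrt n%:R ^+ 2 :> R.
  by rewrite !sqr_sqrtr ?ler0n.
have sa : Num.sqrt d.+1%:R <= 2 * Num.sqrt a%:R :> R.
  rewrite -[leLHS]ger0_norm ?sqrtr_ge0// -[leRHS]ger0_norm ?mulr_ge0 ?sqrtr_ge0//.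
  by rewrite -ler_sqr ?nnegrE ?normr_ge0// !real_normK ?num_real// exprMn !sqr_sqrtr ?ler0n//; lra.
move: sd0 sa; rewrite -sqrtr_gt0 in a0; rewrite -sqrtr_gt0 in b0; rewrite -sqrtr_gt0 in n0.
move: a0 b0 n0.
move: (Num.sqrt a%:R) (Num.sqrt b%:R) (Num.sqrt n%:R) (Num.sqrt d.+1%:R).
move=> x y z w x0 y0 z0 w0 wx zxy.
have zs : z <= x + y by rewrite -(@ler_pXn2r _ 2)// ?nnegrE ?addr_ge0 ?ltW//; nra.
apply: (@le_trans _ _ (z * (x^-1 + y^-1))).
  have -> : z * (x^-1 + y^-1) = z / (x * y) * (x + y) by field; rewrite !gt_eqF.
  have -> : z / x * (z / y) = z / (x * y) * z by field; rewrite !gt_eqF.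
  by rewrite ler_pM2l// divr_gt0// mulr_gt0.
rewrite ler_pM2l// lerD2r -[2 / w]invrK lef_pV2 ?posrE ?invr_gt0 ?divr_gt0//.
by rewrite invf_div ler_pdivrMr// mulrC.
Qed.

(** Reversing the second sum gives the first one, so the constant is [(2 + 1) * 2]. *)
Lemma sum_expR_gap_le (n : nat) :
  \sum_(d < n) expR (2^-1 * ((ln n%:R - ln (maxn d 1)%:R) + (ln n%:R - ln (n - d)%:R)))
  <= 6 * n%:R :> R.
Proof.
apply: (@le_trans _ _ (\sum_(d < n) Num.sqrt n%:R *
  (2 * (Num.sqrt d.+1%:R)^-1 + (Num.sqrt (n - d)%:R)^-1) :> R)).
  by apply: ler_sum => d _; exact: expR_gap_le.
rewrite -mulr_sumr big_split /= -mulr_sumr.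
rewrite [X in _ + X](reindex_inj rev_ord_inj) /=.
rewrite [X in _ + X](eq_bigr (fun d : 'I_n => (Num.sqrt (d.+1%:R : R))^-1)); last first.
  by move=> d _; rewrite subKn.
have := sum_inv_sqrt_le R n; have := sqr_sqrtr (ler0n R n).
have := sqrtr_ge0 (n%:R : R).
set S := \sum_(d < n) _; move: (Num.sqrt n%:R) => z z0 <- Sz.
by nra.
Qed.

(** At this time the joint probability at distance [d] exceeds the product of the single ones by a
    factor at most the summand of [sum_expR_gap_le], because [t * C * f(n) = 1 / 2]. *)
Lemma scaled_cdf_le (C : R) (n : nat) : 0 < C -> (0 < n)%N ->
  (forall d : nat, (d <= n)%N -> tailsum p n - tailsum p d <=
      C * (n%:R * tailf p n%:R) * (ln n%:R - ln (maxn d 1)%:R)) ->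
  cdf_scaled p n (2 * C)^-1 <= 5 / 6.
Proof.
move=> C0 n_gt0 gap; rewrite /cdf_scaled.
have fn := tailf_gt0 pmf rv n%:R.
have n0 : 0 < n%:R :> R by rewrite ltr0n.
set t := _ / tailf p n%:R; have t0 : 0 < t by rewrite divr_gt0// invr_gt0 mulr_gt0.
pose mu := n%:R * expR (- (t * (n%:R^-1 * tailsum p n))).
have mu0 : 0 < mu by rewrite mulr_gt0// expR_gt0.
(* Here [mu] is the mean of [Z], and [l = 1 / (6 mu)] minimizes [1 - 2 l mu + 6 l^2 mu^2], with
   minimum [5 / 6]. *)
have := @cdfT_second_moment _ p pmf n t (6 * mu)^-1 n_gt0 (ltW t0).
under eq_bigr do rewrite arc_prob_hit//.
rewrite sumr_const card_ord -[X in _ - _ * X + _]mulr_natl -/mu.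
set Q := \sum_(i < n) _ => le_cdf.
suff Qle : Q <= 6 * mu ^+ 2.
  apply: le_trans le_cdf _; apply: (@le_trans _ _
      (1 - 2 * (6 * mu)^-1 * mu + (6 * mu)^-1 ^+ 2 * (6 * mu ^+ 2))).
    by rewrite lerD2l ler_wpM2l// sqr_ge0.
  by rewrite le_eqVlt; apply/orP; left; apply/eqP; field; rewrite gt_eqF.
pose F d := expR (- (t * (n%:R^-1 * (tailsum p d + tailsum p (n - d))))).
(* Rotation invariance: a pair of points enters only through its distance. *)
have -> : Q = n%:R * \sum_(d < n) F d.
  rewrite /Q exchange_big /=.
  rewrite (eq_bigr (fun j : 'I_n => \sum_(d < n) F d)).
    by rewrite sumr_const card_ord mulr_natl.
  move=> j _; rewrite -(sum_start j F n_gt0); apply: eq_bigr => i _.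
  by rewrite (arc_prob_hit2 pmf (ltn_ord i) (ltn_ord j)).
have -> : 6 * mu ^+ 2 =
    n%:R * (expR (- (t * (n%:R^-1 * tailsum p n))) ^+ 2 * (6 * n%:R)).
  by rewrite /mu; ring.
rewrite ler_pM2l//; apply: le_trans _ (ler_wpM2l _ (sum_expR_gap_le n)); last first.
  exact: sqr_ge0.
rewrite mulr_sumr; apply: ler_sum => d _.
have dn : (d < n)%N := ltn_ord d.
rewrite expr2 -!expRD ler_expR.
have := gap d (ltnW dn); have := gap (n - d)%N (leq_subr _ _).
rewrite (_ : maxn (n - d) 1 = n - d)%N; last by lia.
set u := ln n%:R - ln (maxn d 1)%:R; set v := ln n%:R - _.
move=> gap1 gap2.
have scale : t / n%:R * (C * (n%:R * tailf p n%:R) * (u + v)) = 2^-1 * (u + v).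
  by rewrite /t; field; rewrite !gt_eqF.
have tn : 0 <= t / n%:R by rewrite divr_ge0// ltW.
have : t / n%:R * (2 * tailsum p n - tailsum p d - tailsum p (n - d)) <= 2^-1 * (u + v).
  by rewrite -scale ler_wpM2l//; lra.
by lra.
Qed.

End SecondMoment.

(** * Distribution functions and limits along subsequences *)

Section MonotoneLimits.
Variable R : realType.

(* A monotone function has countably many jumps, while an interval has positive Lebesgue measure. *)
Lemma df_continuity_point (G : R -> R) (a b : R) : distribution_function G -> a < b ->
  exists2 x, a < x < b & {for x, continuous G}.
Proof.
move=> [ndG [rcG _]] ab; apply: contrapT => no_cont.
have ndGab : {in `[a, b] &, {homo G : x y / x <= y}} by move=> x y _ _; exact: ndG.
have : countable (`]a, b[%classic : set R).
  apply: sub_countable (discontinuity_countable ndGab); apply: subset_card_le => x /= xab.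
  split=> //.
  have cvl : cvg (G y @[y --> x^'-]).
    apply: nondecreasing_at_left_is_cvgr; apply: nearW => z; first by move=> ? ? _ _; exact: ndG.
    by exists (G x) => _ [y /= + <-]; rewrite in_itv/= => /andP[_ /ltW]; exact: ndG.
  split=> //; first by apply/cvg_ex; exists (G x); exact: rcG.
  apply/eqP => lr; apply: no_cont; exists x; first by rewrite in_itv in xab.
  apply/left_right_continuousP; split; last exact: rcG.
  by rewrite -[X in _ --> X](cvg_lim (@Rhausdorff R) (rcG x)) -lr.
move/countable_lebesgue_measure0; rewrite lebesgue_measure_itv/= lte_fin ab -EFinB => -[].
by move/eqP; rewrite subr_eq0 gt_eqF.
Qed.

Lemma df_ge0 (G : R -> R) (x : R) : distribution_function G -> 0 <= G x.
Proof.
move=> [ndG [_ [Gm _]]]; apply: (cvgr_to_le Gm).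
by apply: filterS (nbhs_ninfty_le (num_real x)) => y; exact: ndG.
Qed.

Lemma df_le1 (G : R -> R) (x : R) : distribution_function G -> G x <= 1.
Proof.
move=> [ndG [_ [_ Gp]]]; apply: (cvgr_to_ge Gp).
by apply: filterS (nbhs_pinfty_ge (num_real x)) => y; exact: ndG.
Qed.

(** A strictly increasing sequence of naturals satisfies [k <= nk k]. *)
Lemma near_increasing (nk : nat -> nat) (P : nat -> Prop) :
  {homo nk : a b / (a < b)%N} -> (\forall n \near \oo, P n) ->
  \forall k \near \oo, P (nk k).
Proof.
move=> inc [N _ PN]; exists N => // k /= Nk; apply: PN => /=; apply: leq_trans Nk _.
by elim: k => // k IH; apply: leq_ltn_trans IH (inc _ _ _).
Qed.

End MonotoneLimits.

Theorem mainTheorem5 (R : realType) (p : nat -> R) :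
  radius_pmf p ->
  regvar (tailf p) (-1) ->
  (* limsup_n sup_{n^beta <= x <= n} x f(x) / (n f(n)) < oo *)
  (forall beta : R, 0 < beta < 1 ->
     exists B : R, exists N : nat, forall n : nat, (N <= n)%N ->
       forall x : R, (n%:R) `^ beta <= x <= n%:R ->
         x * tailf p x <= B * (n%:R * tailf p n%:R)) ->
  (* limsup_n (sum_{i=1}^{floor(n^beta)} f(i)) / (f(n) n ln n) < oo *)
  (forall beta : R, 0 < beta < 1 ->
     exists D : R, exists N : nat, forall n : nat, (N <= n)%N ->
       \sum_(1 <= i < `|Num.floor ((n%:R) `^ beta)|%N.+1) tailf p i%:R
         <= D * (tailf p n%:R * n%:R * ln (n%:R))) ->
  (* tightness of (f(n) T_n)_{n >= 1} *)
  (forall eps : R, 0 < eps ->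
     exists M : R, forall n : nat, (0 < n)%N -> 1 - cdf_scaled p n M <= eps) /\
  (* every subsequential distributional limit is non-degenerate with compact support *)
  (forall (nk : nat -> nat) (G : R -> R),
     (forall k, (0 < nk k)%N) ->
     {homo nk : a b / (a < b)%N} ->
     distribution_function G ->
     (forall x : R, {for x, continuous G} ->
        cdf_scaled p (nk k) x @[k --> \oo] --> G x) ->
     ~ degenerate_df G /\ compact_support_df G).
Proof.
move=> pmf rv hB hD.
have half01 : 0 < (2^-1 : R) < 1 by apply/andP; split; lra.
have [B [N1 {}hB]] := hB _ half01; have [D [N2 {}hD]] := hD _ half01.
have fpos := tailf_gt0 pmf rv.
split=> [eps eps0|nk G nk_gt0 nk_inc dfG cvG].
  (* The absolute value keeps the witness nonnegative when [eps > 1]. *)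
  exists `|ln eps| => n n_gt0.
  have := scaled_cdf_ge_exp pmf n_gt0 (normr_ge0 (ln eps)) (fpos _).
  suff : expR (- `|ln eps|) <= eps by lra.
  by rewrite -[leRHS]lnK ?posrE// ler_expR lerNl -normrN ler_norm.
split.
  (* For [c > 0], [G] vanishes near [c / 2], against the exponential lower bound there. *)
  move=> [c Gc]; have [c0|c0] := ltP 0 c.
    have c2 : 0 < c / 2 by lra.
    have c2c : c / 2 < c by lra.
    have contG : {for c / 2, continuous G}.
      apply: cvg_near_cst; apply: filterS (lt_nbhsl c2c) => y yc.
      by rewrite !Gc yc c2c.
    have exp_le : \forall k \near \oo, 1 - expR (- (c / 2)) <= cdf_scaled p (nk k) (c / 2).
      apply: nearW => k; exact: (scaled_cdf_ge_exp pmf (nk_gt0 k) (ltW c2) (fpos _)).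
    have : 1 - expR (- (c / 2)) <= G (c / 2) by exact: cvgr_to_ge (cvG _ contG) exp_le.
    have : expR (- (c / 2)) < 1 by rewrite -[ltRHS]expR0 ltr_expR oppr_lt0.
    by rewrite Gc c2c /=; lra.
  (* For [c <= 0], [G] is 1 near the positive point [1 / (2 C)], against the bound [5 / 6]. *)
  have [C C0 gap] := tailsum_gap pmf rv hB hD.
  have x0 : 0 < (2 * C)^-1 by rewrite invr_gt0 mulr_gt0.
  have contG : {for (2 * C)^-1, continuous G}.
    apply: cvg_near_cst; apply: filterS (lt_nbhsr x0) => y y0.
    by rewrite !Gc !ltNge (le_trans c0 (ltW y0)) (le_trans c0 (ltW x0)).
  have le56 : \forall k \near \oo, cdf_scaled p (nk k) (2 * C)^-1 <= 5 / 6.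
    apply: filterS (near_increasing nk_inc gap) => k; exact: scaled_cdf_le.
  have : G (2 * C)^-1 <= 5 / 6 by exact: cvgr_to_le (cvG _ contG) le56.
  by rewrite Gc ltNge (le_trans c0 (ltW x0)) /=; lra.
(* Convergence is available only at continuity points, so the ends of the support are chosen among
   them: [a < 0], where [cdfT] vanishes, and [b > 8], as the block bound requires. *)
have [a /andP[_ a0] conta] := df_continuity_point dfG (ltrN10 R).
have [b /andP[b8 _] contb] : exists2 x, 8 < x < 9 & {for x, continuous G}.
  by apply: df_continuity_point => //; lra.
have [ndG _] := dfG.
exists a, b => x; split=> [xa|bx].
  apply/le_anti; rewrite df_ge0// andbT; apply: le_trans (ndG _ _ (ltW xa)) _.
  apply: (cvgr_to_le (cvG _ conta)); apply: nearW => k.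
  by rewrite /cdf_scaled /cdfT pmulr_llt0 ?invr_gt0// a0.
apply/le_anti; rewrite df_le1//=; apply: le_trans _ (ndG _ _ bx).
apply/ler_addgt0Pr => e e0.
(* The ceiling gives [4 / K <= e], and [.+2] ensures [2 <= K]. *)
pose K := (`|Num.ceil (4 / e)|.+2)%N.
have Ke : 4 / K%:R <= e.
  rewrite ler_pdivrMr ?ltr0n// mulrC -ler_pdivrMr//.
  apply: le_trans (ceil_ge _) _.
  by rewrite -[K%:R]/(K%:~R) ler_int (le_trans (ler_norm _))// -abszE lez_nat !leqW.
have near_b := near_increasing nk_inc (scaled_cdf_ge_blocks pmf rv (isT : (2 <= K)%N) (ltW b8)).
have : 1 - 4 / K%:R <= G b by exact: cvgr_to_ge (cvG _ contb) near_b.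
by lra.
Qed.
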